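(* Let $m\ge1$ be an integer. For all $p,q\in\mathcal P_{2m}(\mathbb R)$, $$\mathbf Q_m(p\,\square_{2m}\,q)=\mathbf Q_m(\mathrm{Sym}(p))\boxtimes_m\mathbf Q_m(\mathrm{Sym}(q))\boxtimes_m\operatorname{Dil}_{1/4}\mathcal H_m\left[\begin{smallmatrix}2,\ 2\\ 1-\frac1{2m},\ 2+\frac1m\end{smallmatrix}\right].$$
   Context: $\mathcal P_n$ is the set of monic polynomials of degree $n$ over $\mathbb C$, and $\mathcal P_n(\mathbb R)$ the subset of those with all roots real. For $p\in\mathcal P_n$ the coefficients $\mathsf e_k(p)$ are defined by $p(x)=\sum_{k=0}^n x^{n-k}(-1)^k\mathsf e_k(p)$. For a nonzero scalar $\alpha$, $[\operatorname{Dil}_\alpha p](x)=\alpha^np(\alpha^{-1}x)$. Falling factorial: $(a)^{\underline k}=a(a-1)\cdots(a-k+1)$. Finite free convolutions on $\mathcal P_n$, for $0\le k\le n$: $\mathsf e_k(p\boxplus_n q)=(n)^{\underline k}\sum_{i+j=k}\frac{\mathsf e_i(p)\mathsf e_j(q)}{(n)^{\underline i}(n)^{\underline j}}$ and $\mathsf e_k(p\boxtimes_n q)=\binom nk^{-1}\mathsf e_k(p)\mathsf e_k(q)$. The symmetrization of $p\in\mathcal P_n$ is $\mathrm{Sym}(p)=p\boxplus_n(\operatorname{Dil}_{-1}p)$. The map $\mathbf Q_m:\mathcal P_{2m}\to\mathcal P_m$ is defined by $\mathsf e_k(\mathbf Q_m(p))=(-1)^k\mathsf e_{2k}(p)$ for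 $0\le k\le m$. Hypergeometric polynomials: for real $b_1,\dots,b_j$ and real $a_1,\dots,a_i\notin\{0,\frac1n,\dots,\frac{n-1}n\}$, $\mathcal H_n\left[\begin{smallmatrix}b_1,\dots,b_j\\ a_1,\dots,a_i\end{smallmatrix}\right]\in\mathcal P_n$ is the monic polynomial with $\mathsf e_k=\binom nk\frac{\prod_t(nb_t)^{\underline k}}{\prod_s(na_s)^{\underline k}}$ for $0\le k\le n$. Finite free commutator: let $z_n(x)=\sum_{k=0}^{\lfloor n/2\rfloor}x^{n-2k}(-1)^k\binom n{2k}(n)^{\underline k}\frac{k!}{(2k)!}\frac{n+1-k}{n+1}$; for $p,q\in\mathcal P_n$, $p\,\square_n\,q=\mathrm{Sym}(p)\boxtimes_n\mathrm{Sym}(q)\boxtimes_n z_n$. *)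

(* Defs.v *)
From mathcomp Require Import all_boot all_order all_algebra.
From mathcomp Require Import reals.
From mathcomp Require Export complex.

Set Implicit Arguments.
Unset Strict Implicit.
Unset Printing Implicit Defensive.

Import Order.TTheory GRing.Theory Num.Theory.
Local Open Scope ring_scope.
Local Open Scope complex_scope.

(* (x)^{\underline k} for a non-integer x; [n ^_ k] is its nat counterpart. *)
Definition falling (F : pzRingType) (x : F) (k : nat) : F :=
  \prod_(i < k) (x - i%:R).

Section FiniteFree.
Variable C : numFieldType.
Implicit Types (p q : {poly C}) (n m k : nat).

Definition monic_deg n p : bool := (p \is monic) && (size p == n.+1).

Definition real_rooted n p : Prop :=
  monic_deg n p /\ forall x : C, root p x -> x \is Num.real.

(* The operations below are total on {poly C}; they carry their intended
   meaning on polynomials satisfying [monic_deg n]. *)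

(* e_k(p) for p of degree n; meaningful for k <= n only, since n - k is
   truncated. *)
Definition ecoef n p k : C := (-1) ^+ k * p`_(n - k).

Definition epoly n (e : nat -> C) : {poly C} :=
  \sum_(k < n.+1) ((-1) ^+ k * e k) *: 'X^(n - k).

Definition Dil n (a : C) p : {poly C} := a ^+ n *: (p \Po (a^-1 *: 'X)).

Definition boxplus n p q : {poly C} :=
  epoly n (fun k => (n ^_ k)%:R *
    \sum_(i < k.+1)
      (ecoef n p i * ecoef n q (k - i)) / ((n ^_ i)%:R * (n ^_ (k - i))%:R)).

Definition boxtimes n p q : {poly C} :=
  epoly n (fun k => ('C(n, k))%:R^-1 * (ecoef n p k * ecoef n q k)).

Definition Sym n p : {poly C} := boxplus n p (Dil n (-1) p).

(* Q_m : P_{2m} -> P_m *)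
Definition Qmap m p : {poly C} :=
  epoly m (fun k => (-1) ^+ k * ecoef (2 * m) p (2 * k)).

Definition zpoly n : {poly C} :=
  \sum_(k < (n./2).+1)
    ((-1) ^+ k * ('C(n, 2 * k))%:R * (n ^_ k)%:R
      * ((k`!)%:R / ((2 * k)`!)%:R)
      * ((n + 1 - k)%:R / (n + 1)%:R)) *: 'X^(n - 2 * k).

Definition commutator n p q : {poly C} :=
  boxtimes n (boxtimes n (Sym n p) (Sym n q)) (zpoly n).

Lemma ecoef_epoly n (e : nat -> C) k :
  (k <= n)%N -> ecoef n (epoly n e) k = e k.
Proof.
move=> kn; rewrite /ecoef /epoly coef_sum.
have kn1 : (k < n.+1)%N by [].
rewrite (bigD1 (Ordinal kn1)) //= coefZ coefXn eqxx mulr1.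
rewrite big1 ?addr0 ?mulrA -?exprMn ?mulN1r ?opprK ?expr1n ?mul1r //.
move=> i; rewrite -val_eqE /= => ik; rewrite coefZ coefXn.
case: eqP => [nki|]; last by rewrite mulr0.
by case/eqP: ik; rewrite -(subKn kn) nki subKn // -ltnS.
Qed.

Lemma epoly_ecoef n p : monic_deg n p -> epoly n (ecoef n p) = p.
Proof.
move=> /andP[_ /eqP sp]; apply/polyP=> j; rewrite /epoly coef_sum.
case: (ltnP n j) => nj.
  rewrite [RHS]nth_default ?sp // big1 // => i _; rewrite coefZ coefXn.
  by rewrite gtn_eqF ?mulr0 // (leq_ltn_trans (leq_subr _ _) nj).
have nj1 : (n - j < n.+1)%N by rewrite ltnS leq_subr.
rewrite (bigD1 (Ordinal nj1)) //= coefZ coefXn subKn // eqxx mulr1.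
rewrite /ecoef subKn // mulrA -exprMn mulN1r opprK expr1n mul1r.
rewrite big1 ?addr0 // => i; rewrite -val_eqE /= => ij.
rewrite coefZ coefXn; case: eqP => [jE|]; last by rewrite mulr0.
by case/eqP: ij; rewrite jE subKn // -ltnS.
Qed.

End FiniteFree.

Arguments zpoly {C} n.

Section Hypergeometric.
Variable R : rcfType.

(* The lower parameters must avoid {0, 1/n, ..., (n-1)/n}, so that no
   denominator below vanishes; [hypergeom] is a total function and takes junk
   values otherwise. *)
Definition admissible n (a : R) : Prop :=
  forall i : 'I_n, a <> i%:R / n%:R.

Definition hypergeom n (b a : seq R) : {poly R[i]} :=
  epoly n (fun k =>
    (('C(n, k))%:R * ((\prod_(t <- b) falling (n%:R * t) k)
                      / (\prod_(s <- a) falling (n%:R * s) k)))%:C).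

Lemma admissible_1_sub m :
  (0 < m)%N -> admissible m (1 - 1 / (2 * m)%:R : R).
Proof.
rewrite div1r => m0 i /(congr1 (fun x => x * (2 * m)%:R)).
have m0' : m%:R != 0 :> R by rewrite pnatr_eq0 -lt0n.
have m2' : (2 * m)%:R != 0 :> R by rewrite pnatr_eq0 muln_eq0 -lt0n m0.
rewrite mulrBl mul1r mulVf // natrM mulrCA -!mulrA mulVf // mulr1.
move/eqP; rewrite subr_eq -[X in _ + X]mulr1n -!natrM -natrD eqr_nat.
by move/eqP/(congr1 odd); rewrite oddD !oddM.
Qed.

Lemma admissible_2_add m :
  (0 < m)%N -> admissible m (2 + 1 / m%:R : R).
Proof.
rewrite div1r => m0 i; apply/eqP; rewrite gt_eqF //.
have m0' : 0 < m%:R :> R by rewrite ltr0n.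
rewrite ltr_pdivrMr // mulrDl mulVf ?gt_eqF // -natrM -[X in _ + X]mulr1n.
rewrite -natrD ltr_nat addn1 ltnS; apply: (leq_trans (ltnW (ltn_ord i))).
by rewrite leq_pmull.
Qed.

End Hypergeometric.

(* Main.v *)
Require Import Defs.
From mathcomp Require Import all_boot all_order all_algebra.
From mathcomp Require Import reals.
From mathcomp Require Import ring.

Import Order.TTheory GRing.Theory Num.Theory.
Local Open Scope ring_scope.

(** Both sides are polynomials of degree [m] given by their coefficients
    [e_k], so the identity is checked for each [k <= m].  The multiplicative
    convolutions only multiply coefficients, hence
    [e_2k(Sym p) * e_2k(Sym q)] factors out of both sides ([Qmap_commutator]),
    and what remains is a scalar identity, [commutator_weight_eq], between the
    weight contributed by [z_2m] and the one contributed by the dilated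
    hypergeometric polynomial.  Writing [(x)_k] for falling factorials, the lower parameters
    are [m (1 - 1/2m) = m - 1/2] and [m (2 + 1/m) = 2m + 1], and the
    scalar identity follows from
      [(2m)_2k = 4^k (m)_k (m - 1/2)_k]                 ([falling_double])
    applied to the binomials [C(2m, 2k)] and [C(m, k)], and from
      [(2m)_k / (2m + 1)_k = (2m + 1 - k) / (2m + 1)]   ([falling_shift]). *)

Lemma fallingS (F : pzRingType) (x : F) k :
  falling x k.+1 = falling x k * (x - k%:R).
Proof. by rewrite /falling big_ord_recr. Qed.

Lemma falling_nat (F : pzRingType) n k :
  falling (n%:R : F) k = (n ^_ k)%:R.
Proof.
elim: k => [|k IHk]; first by rewrite /falling big_ord0.
rewrite fallingS IHk ffactnSr natrM; case: (leqP k n) => [kn | nk].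
  by rewrite natrB.
by rewrite ffact_small // !mul0r.
Qed.

(** Both sides are [(x + 1)_(k+1)]. *)
Lemma falling_shift (F : comPzRingType) (x : F) k :
  falling (x + 1) k * (x + 1 - k%:R) = (x + 1) * falling x k.
Proof.
rewrite -fallingS /falling big_ord_recl subr0; congr (_ * _).
by apply: eq_bigr => i _; rewrite lift0 -natr1; ring.
Qed.

Lemma falling_double (F : numFieldType) (x : F) k :
  falling (2 * x) (2 * k) = 4 ^+ k * (falling x k * falling (x - 1 / 2) k).
Proof.
elim: k => [|k IHk]; first by rewrite muln0 /falling !big_ord0 !mulr1.
rewrite mulnS !fallingS IHk -natr1 natrM exprS.
by field.
Qed.

(** On the left, [C(2m, 2k)^-2] times the coefficient [e_2k(z_2m)] up to its
    sign [(-1)^k]; on the right, [C(m, k)^-2] times the coefficient [e_k] of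
    [Dil_(1/4) H_m].  The squares come from the two multiplicative convolutions
    on each side. *)
Lemma commutator_weight_eq (F : numFieldType) m k :
  (0 < m)%N -> (k <= m)%N ->
  ('C(2 * m, 2 * k))%:R^-1 *
    ((2 * m) ^_ k)%:R * ((k`!)%:R / ((2 * k)`!)%:R)
      * ((2 * m + 1 - k)%:R / (2 * m + 1)%:R)
  = ('C(m, k))%:R^-1 * (1 / 4) ^+ k
      * ((\prod_(t <- [:: 2; 2]) falling (m%:R * t) k)
         / (\prod_(s <- [:: 1 - 1 / (2 * m)%:R; 2 + 1 / m%:R])
              falling (m%:R * s) k)) :> F.
Proof.
move=> m_gt0 le_km; rewrite !big_cons !big_nil !mulr1.
have le_k2m : (k <= 2 * m)%N by rewrite (leq_trans le_km) ?leq_pmull.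
have le_2k2m : (2 * k <= 2 * m)%N by rewrite leq_mul2l.
have m_neq0 : m%:R != 0 :> F by rewrite pnatr_eq0 -lt0n.
have -> : m%:R * (1 - 1 / (2 * m)%:R) = m%:R - 1 / 2 :> F.
  by rewrite natrM; field.
have -> : m%:R * (2 + 1 / m%:R) = (2 * m)%:R + 1 :> F.
  by rewrite natrM; field.
have -> : m%:R * 2 = (2 * m)%:R :> F by rewrite natrM mulrC.
have nat_neq0 n : (0 < n)%N -> n%:R != 0 :> F by rewrite pnatr_eq0 -lt0n.
have shiftE := falling_shift F (2 * m)%:R k.
have doubleE := falling_double F m%:R k.
rewrite -natrM !falling_nat in doubleE; rewrite falling_nat in shiftE *.
have fact2E : (2 * k)`!%:R * 'C(2 * m, 2 * k)%:R = ((2 * m) ^_ (2 * k))%:R :> F.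
  by rewrite -natrM mulnC bin_ffact.
have factE : k`!%:R * 'C(m, k)%:R = (m ^_ k)%:R :> F.
  by rewrite -natrM mulnC bin_ffact.
rewrite natr1 falling_nat in shiftE *.
rewrite (_ : (2 * m + 1 - k)%N = ((2 * m).+1 - k)%N) ?addn1 //.
rewrite -natrB ?leqW // in shiftE.
have C2_neq0 : 'C(2 * m, 2 * k)%:R != 0 :> F by rewrite nat_neq0 ?bin_gt0.
have C_neq0 : 'C(m, k)%:R != 0 :> F by rewrite nat_neq0 ?bin_gt0.
have f_neq0 : (k`!)%:R != 0 :> F by rewrite nat_neq0 ?fact_gt0.
have S_neq0 : ((2 * m).+1)%:R != 0 :> F by rewrite nat_neq0.
have A_neq0 : ((2 * m).+1 ^_ k)%:R != 0 :> F by rewrite nat_neq0 ?ffact_gt0 ?leqW.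
have h4_neq0 : 4 ^+ k != 0 :> F by rewrite expf_neq0 ?pnatr_eq0.
(* [(m - 1/2)_k] is a factor of [(2m)_2k], which is positive as [k <= m]. *)
have H_neq0 : falling (m%:R - 1 / 2) k != 0 :> F.
  apply/eqP => H0; move: doubleE; rewrite H0 !mulr0 => /eqP.
  by apply/negP; rewrite nat_neq0 ?ffact_gt0.
rewrite -fact2E -factE in doubleE.
(* Solving [doubleE] for [(2k)!] and [shiftE] for [2m + 1 - k] leaves a rational
   identity in independent unknowns, with nonzero denominators. *)
have := S_neq0; have := A_neq0.
move: doubleE shiftE C2_neq0 C_neq0 f_neq0 h4_neq0 H_neq0.
rewrite expr_div_n expr1n.
move: (4 ^+ k) (falling _ _) ('C(2 * m, _)%:R) ('C(m, k)%:R) (k`!%:R).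
move: ((2 * k)`!%:R) (((2 * m).+1 ^_ k)%:R) (((2 * m) ^_ k)%:R) ((2 * m).+1%:R).
move: (_%:R) => d f2 A P S h H C2 C f dE sE C2n Cn fn hn Hn An Sn.
have -> : f2 = h * (f * C * H) / C2 by rewrite -dE mulfK.
have -> : d = S * P / A by rewrite -sE mulrC mulKf.
by field; rewrite An Sn C2n Cn fn hn Hn.
Qed.

Lemma ecoef_Dil (C : numFieldType) n (a : C) (p : {poly C}) k :
  a != 0 -> (k <= n)%N -> ecoef n (Dil n a p) k = a ^+ k * ecoef n p k.
Proof.
move=> a_neq0 le_kn; rewrite /ecoef /Dil coefZ.
have -> : p \Po (a^-1 *: 'X) = \poly_(i < size p) (a^-1 ^+ i * p`_i).
  rewrite comp_polyE poly_def; apply: eq_bigr => i _.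
  by rewrite exprZn scalerA mulrC.
rewrite coef_poly; case: ltnP => [_ | le_pk]; last first.
  by rewrite [p`_ _]nth_default // !mulr0.
rewrite [RHS]mulrCA; congr (_ * _); rewrite mulrA; congr (_ * _).
by rewrite -{1}(subnKC le_kn) exprD exprVn mulfK ?expf_neq0.
Qed.

Lemma ecoef_zpoly (C : numFieldType) n k :
  (2 * k <= n)%N ->
  ecoef n (zpoly n : {poly C}) (2 * k) =
    (-1) ^+ k * ('C(n, 2 * k))%:R * (n ^_ k)%:R
      * ((k`!)%:R / ((2 * k)`!)%:R) * ((n + 1 - k)%:R / (n + 1)%:R).
Proof.
move=> le_2kn; rewrite /ecoef /zpoly coef_sum.
have lt_k : (k < (n./2).+1)%N by rewrite ltnS geq_half_double -mul2n.
rewrite (bigD1 (Ordinal lt_k)) //= coefZ coefXn eqxx mulr1.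
(* The sign [(-1)^(2k)] in the definition of [e_2k] is trivial. *)
rewrite exprM sqrrN expr1n expr1n mul1r big1 ?addr0 // => i.
rewrite -val_eqE /= => neq_ik; rewrite coefZ coefXn.
have le_2in : (2 * i <= n)%N.
  by rewrite mul2n -geq_half_double -ltnS.
case: eqP => [eq_ik|]; last by rewrite mulr0.
case/eqP: neq_ik; apply/eqP; rewrite -(eqn_pmul2l (isT : 0 < 2)%N).
by rewrite -(subKn le_2in) -eq_ik subKn.
Qed.

Lemma eq_epoly (C : numFieldType) n (e f : nat -> C) :
  (forall k, (k <= n)%N -> e k = f k) -> epoly n e = epoly n f.
Proof. by move=> eq_ef; apply: eq_bigr => i _; rewrite eq_ef // -ltnS. Qed.

Lemma ecoef_boxtimes (C : numFieldType) n (p q : {poly C}) k :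
  (k <= n)%N ->
  ecoef n (boxtimes n p q) k
  = ('C(n, k))%:R^-1 * (ecoef n p k * ecoef n q k).
Proof. exact: ecoef_epoly. Qed.

Lemma ecoef_Qmap (C : numFieldType) m (p : {poly C}) k :
  (k <= m)%N -> ecoef m (Qmap m p) k = (-1) ^+ k * ecoef (2 * m) p (2 * k).
Proof. exact: ecoef_epoly. Qed.

(** Reduction of a factorization of [Q_m] of the commutator, with an arbitrary
    third factor [h], to a scalar identity not involving [p] and [q]. *)
Lemma Qmap_commutator (C : numFieldType) m (p q h : {poly C}) :
  (forall k, (k <= m)%N ->
     ('C(2 * m, 2 * k))%:R^-1 *
       ((2 * m) ^_ k)%:R * ((k`!)%:R / ((2 * k)`!)%:R)
         * ((2 * m + 1 - k)%:R / (2 * m + 1)%:R)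
     = ('C(m, k))%:R^-1 ^+ 2 * ecoef m h k) ->
  Qmap m (commutator (2 * m) p q)
  = boxtimes m
      (boxtimes m (Qmap m (Sym (2 * m) p)) (Qmap m (Sym (2 * m) q))) h.
Proof.
move=> weightE; apply: eq_epoly => k le_km.
have le_2k2m : (2 * k <= 2 * m)%N by rewrite leq_mul2l.
rewrite /commutator !ecoef_boxtimes // !ecoef_Qmap // ecoef_zpoly //.
have C2_neq0 : 'C(2 * m, 2 * k)%:R != 0 :> C.
  by rewrite pnatr_eq0 -lt0n bin_gt0.
move: (ecoef _ (Sym _ p) _) (ecoef _ (Sym _ q) _) => s t.
(* The right-hand side carries one sign [(-1)^k] for each factor [Q_m]. *)
transitivity (((-1) ^+ k * (-1) ^+ k) * (s * t)
  * (('C(m, k))%:R^-1 ^+ 2 * ecoef m h k)); last by ring.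
rewrite -weightE //; move: ((2 * k)`!%:R^-1) ((2 * m + 1)%:R^-1) => f2 S.
move: (_ - _)%N%:R (_ ^_ k)%:R k`!%:R => d P f.
by field.
Qed.

Theorem proposition5p4 (R : realType) (m : nat) (hm : (1 <= m)%N)
    (p q : {poly R[i]})
    (hp : real_rooted (2 * m) p) (hq : real_rooted (2 * m) q) :
  Qmap m (commutator (2 * m) p q) =
  boxtimes m
    (boxtimes m (Qmap m (Sym (2 * m) p)) (Qmap m (Sym (2 * m) q)))
    (Dil m (1 / 4)
      (hypergeom m [:: (2 : R); 2] [:: 1 - 1 / (2 * m)%:R; 2 + 1 / m%:R])).
Proof.
apply: Qmap_commutator => k le_km.
rewrite ecoef_Dil //; last by rewrite div1r invr_eq0 pnatr_eq0.
rewrite /hypergeom ecoef_epoly //.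
(* The hypergeometric coefficients are real numbers embedded in [R[i]], so the
   real scalar identity is transported along the embedding. *)
have := congr1 (real_complex R) (commutator_weight_eq R m k hm le_km).
move: (_ / \prod_(s <- _) _) => w.
rewrite !(rmorphM, fmorphV, rmorphXn, rmorph_nat, rmorph1) => ->.
rewrite -mulrA [RHS]mulrCA [in LHS]mulrCA; congr (_ * _).
by rewrite expr2 -[RHS]mulrA mulKf // pnatr_eq0 -lt0n bin_gt0.
Qed.
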